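(* Let $n\ge 3$. Every one-dimensional non-split extension of the solvable Lie algebra $\mathfrak{s}^3_{n,1}$ is isomorphic to the algebra $\mathfrak{s}^3_{n+1,1}$.
   Context: All algebras are finite-dimensional over $\mathbb{C}$; brackets are antisymmetric and unlisted brackets of basis vectors are zero. $\mathfrak{s}^3_{n,1}$: basis $x,e_1,\dots,e_n$; $[e_i,e_1]=e_{i+1}$ ($2\le i\le n-1$), $[e_1,x]=e_1+e_2$, $[e_i,x]=(i-1)e_i$ ($2\le i\le n$). Its nilradical is $N=n_{n,1}=\langle e_1,\dots,e_n\rangle$. Extensions: let $L$ be a solvable Lie algebra with nilradical $N$, $\mathbb V$ a vector space, $\theta:L\to\operatorname{End}\mathbb V$ a representation, and $\psi:L\times L\to\mathbb V$ an antisymmetric bilinear map with $$\psi(x,[y,z])+\psi(z,[x,y])+\psi(y,[z,x])+\theta(x)\psi(y,z)+\theta(z)\psi(x,y)+\theta(y)\psi(z,x)=0 .$$ The extension $L(\psi,\theta)$ of $L$ by $\mathbb V$ is $L\oplus\mathbb V$ with bracket $[x+u,y+v]=[x,y]+\psi(x,y)+\theta(x)v-\theta(y)u$. Only extensions whose nilradical is a central extension of $N$ by $\mathbb V$ are considered, equivalently $N\subseteq\operatorname{Ker}\theta$. The extension is one-dimensional if $\dim\mathbb V=1$. Put $\psi^0=\psi|_{N\times N}$ and $\operatorname{Ann}(\psi^0)=\{x\in N:\psi^0(x,N)=0\}$; a one-dimensional extension is non-split if $\operatorname{Ann}(\psi^0)\cap Z(N)=0$, where $Z(N)$ is the center of $N$.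 *)

(* Defs.v *)
From HB Require Import structures.
From mathcomp Require Import all_boot all_order all_algebra.
From mathcomp Require Import ring zify.
From mathcomp Require Export reals complex.

Set Implicit Arguments.
Unset Strict Implicit.
Unset Printing Implicit Defensive.

Import Order.TTheory GRing.Theory Num.Theory VectorInternalTheory.
Local Open Scope ring_scope.

HB.mixin Record isLieAlgebra (K : numFieldType) L of Vector K L := {
  lieb : L -> L -> L;
  lieb_linearr : forall x, linear (lieb x);
  lieb_anti : forall x y, lieb x y = - lieb y x;
  lieb_jacobi : forall x y z,
    lieb x (lieb y z) + lieb y (lieb z x) + lieb z (lieb x y) = 0
}.

#[short(type="lieAlgType")]
HB.structure Definition LieAlgebra (K : numFieldType) :=
  { L of Vector K L & isLieAlgebra K L }.

Definition lie_isomorphic (K : numFieldType) (L1 L2 : lieAlgType K) : Prop :=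
  exists f : 'Hom(L1, L2),
    bijective f /\ forall x y, f (lieb x y) = lieb (f x) (f y).

Section LieTheory.
Context (K : numFieldType) (L : lieAlgType K).
Implicit Types (U W X I N : {vspace L}) (x y z : L).

Lemma lieb_linearl y : linear (lieb^~ y : L -> L).
Proof.
move=> a u v /=; rewrite lieb_anti lieb_linearr opprD -scalerN.
by rewrite -!(lieb_anti _ y).
Qed.

Lemma lieb0r x : lieb x 0 = 0.
Proof. by have := lieb_linearr x (-1) 0 0; rewrite scaler0 addr0 scaleN1r addNr. Qed.

Lemma lieb_sumr x (I : finType) (c : I -> K) (F : I -> L) :
  lieb x (\sum_i c i *: F i) = \sum_i c i *: lieb x (F i).
Proof.
by elim/big_rec2: _ => [|i a b _ <-]; rewrite ?lieb0r ?lieb_linearr.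
Qed.

Lemma lieb_suml x (I : finType) (c : I -> K) (F : I -> L) :
  lieb (\sum_i c i *: F i) x = \sum_i c i *: lieb (F i) x.
Proof.
rewrite lieb_anti lieb_sumr -sumrN; apply: eq_bigr => i _.
by rewrite -scalerN -lieb_anti.
Qed.

Definition lie_prod U W : {vspace L} :=
  <<[seq lieb u w | u <- vbasis U, w <- vbasis W]>>%VS.

Lemma lie_prod_sub U W X :
  (forall u w, u \in U -> w \in W -> lieb u w \in X) -> (lie_prod U W <= X)%VS.
Proof.
move=> h; apply/span_subvP => _ /allpairsP[[u w] [/= hu hw ->]].
by apply: h; apply: vbasis_mem.
Qed.

Lemma memv_lie_prod U W u w :
  u \in U -> w \in W -> lieb u w \in lie_prod U W.
Proof.
move=> hu hw; rewrite (coord_vbasis hu) lieb_suml rpred_sum // => i _.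
rewrite rpredZ // (coord_vbasis hw) lieb_sumr rpred_sum // => j _.
rewrite rpredZ //; apply: memv_span; apply/allpairsP.
by exists ((vbasis U)`_i, (vbasis W)`_j); rewrite !mem_nth ?size_tuple.
Qed.

Definition lie_ideal I : Prop := forall x y, y \in I -> lieb x y \in I.

Definition lie_nilpotent I : Prop := exists k, iter k (lie_prod I) I = 0%VS.

Definition is_nilradical N : Prop :=
  [/\ lie_ideal N, lie_nilpotent N &
      forall I, lie_ideal I -> lie_nilpotent I -> (I <= N)%VS].

Definition in_center N x : Prop :=
  x \in N /\ forall y, y \in N -> lieb x y = 0.

Record extension (V : vectType K) := Extension {
  ext_rep : 'Hom(L, 'End(V));
  ext_cocycle : 'Hom(L, 'Hom(L, V));
  ext_repP : forall x y v,
    ext_rep (lieb x y) v =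
      ext_rep x (ext_rep y v) - ext_rep y (ext_rep x v);
  ext_cocycle_anti : forall x y, ext_cocycle x y = - ext_cocycle y x;
  ext_cocycleP : forall x y z,
    ext_cocycle x (lieb y z) + ext_cocycle z (lieb x y)
    + ext_cocycle y (lieb z x) + ext_rep x (ext_cocycle y z)
    + ext_rep z (ext_cocycle x y) + ext_rep y (ext_cocycle z x) = 0
}.

Definition in_ann V (E : extension V) N x : Prop :=
  x \in N /\ forall y, y \in N -> ext_cocycle E x y = 0.

Definition non_split V (E : extension V) N : Prop :=
  forall x, in_ann E N x -> in_center N x -> x = 0.

End LieTheory.

Lemma vect_extP (K : numFieldType) (V : vectType K) (u v : V) :
  (forall f : V -> K, (forall a b, f (a + b) = f a + f b) ->
     (forall a, f (- a) = - f a) -> (forall c a, f (c *: a) = c * f a) ->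
     f 0 = 0 -> f u = f v) -> u = v.
Proof.
move=> h; apply: (can_inj v2rK); apply/rowP => j.
by apply: (h (fun w => v2r w 0 j)) => *; rewrite ?linearD ?linearN ?linearZ ?linear0 ?mxE.
Qed.

Definition ext_type (K : numFieldType) (L : lieAlgType K) (V : vectType K)
  (E : extension L V) : Type := (L * V)%type.

Section ExtLie.
Context (K : numFieldType) (L : lieAlgType K) (V : vectType K).
Context (E : extension L V).

HB.instance Definition _ := Vector.copy (ext_type E) (L * V)%type.

Definition ext_lieb (p q : ext_type E) : ext_type E :=
  (lieb p.1 q.1,
   ext_cocycle E p.1 q.1 + ext_rep E p.1 q.2 - ext_rep E q.1 p.2).

Lemma ext_lieb_linearr p : linear (ext_lieb p).
Proof.
case: p => x u a [y v] [z w]; congr pair; first exact: lieb_linearr.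
rewrite /= !linearP !lfunE /= ?lfunE /=.
by apply: vect_extP => f fD fN fZ f0; rewrite !(fD, fN, fZ); ring.
Qed.

Lemma ext_lieb_anti p q : ext_lieb p q = - ext_lieb q p.
Proof.
case: p q => x u [y v]; congr pair; first exact: lieb_anti.
rewrite /= ext_cocycle_anti !opprD opprK -!addrA; congr (_ + _).
by rewrite addrC.
Qed.

Lemma ext_lieb_jacobi p q r :
  ext_lieb p (ext_lieb q r) + ext_lieb q (ext_lieb r p)
  + ext_lieb r (ext_lieb p q) = 0.
Proof.
case: p q r => x u [y v] [z w]; congr pair; first exact: lieb_jacobi.
rewrite /= !ext_repP -[RHS](ext_cocycleP E x y z).
have tD a b c : ext_rep E a (b + c) = ext_rep E a b + ext_rep E a c.
  exact: linearD.
have tN a b : ext_rep E a (- b) = - ext_rep E a b by exact: linearN.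
rewrite !(tD, tN); apply: vect_extP => f fD fN _ _.
by rewrite !(fD, fN); ring.
Qed.

HB.instance Definition _ := isLieAlgebra.Build K (ext_type E)
  ext_lieb_linearr ext_lieb_anti ext_lieb_jacobi.

End ExtLie.

Definition s3 (K : numFieldType) (n : nat) : Type := 'rV[K]_n.+1.

HB.instance Definition _ (K : numFieldType) (n : nat) :=
  Vector.copy (s3 K n) 'rV[K]_n.+1.

Section S3.
Context (K : numFieldType) (n : nat).

(* The basis vector of index i: index 0 is x and 1 <= i <= n is e_i.
   It is 0 for i > n. *)
Definition s3_e (i : nat) : s3 K n := \row_(j < n.+1) (j == i :> nat)%:R.

(* The listed brackets; every other ordered pair of indices gets 0. *)
Definition s3_table (i j : nat) : s3 K n :=
  if j == 1%N then if (2 <= i <= n - 1)%N then s3_e i.+1 else 0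
  else if j == 0%N then
    if i == 1%N then s3_e 1 + s3_e 2
    else if (2 <= i <= n)%N then (i - 1)%N%:R *: s3_e i else 0
  else 0.

Definition s3_lieb (u v : s3 K n) : s3 K n :=
  \sum_(i < n.+1) \sum_(j < n.+1)
    (u 0 i * v 0 j) *: (s3_table i j - s3_table j i).

(* Coordinate i of u, extended by 0 to all natural numbers i. *)
Definition s3_co (u : s3 K n) (i : nat) : K :=
  if insub i is Some j then u 0 j else 0.
Local Notation co := s3_co.

(* For k <= n, coordinate k of the bilinear form with constants s3_table. *)
Definition s3_hco (u v : s3 K n) (k : nat) : K :=
  co v 1 * (if (3 <= k)%N then co u k.-1 else 0)
  + co v 0 * ((if (1 <= k)%N then (k - 1)%:R * co u k else 0)
   + (if k == 1 then co u 1 else if k == 2 then co u 1 else 0)).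

Lemma s3_coE u (i : 'I_n.+1) : co u i = u 0 i.
Proof. by rewrite /s3_co valK. Qed.
Lemma s3_co_out u i : (n < i)%N -> co u i = 0.
Proof. by move=> h; rewrite /s3_co insubN // -leqNgt. Qed.
Lemma s3_coP u v : (forall i, (i <= n)%N -> co u i = co v i) -> u = v.
Proof. by move=> h; apply/rowP => j; rewrite -!s3_coE h // -ltnS. Qed.
Lemma s3_coD u v i : co (u + v) i = co u i + co v i.
Proof. by rewrite /s3_co; case: insub => [j|]; rewrite ?mxE ?addr0. Qed.
Lemma s3_coZ a u i : co (a *: u) i = a * co u i.
Proof. by rewrite /s3_co; case: insub => [j|]; rewrite ?mxE ?mulr0. Qed.
Lemma s3_co0 i : co 0 i = 0.
Proof. by rewrite /s3_co; case: insub => [j|]; rewrite ?mxE. Qed.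
Lemma s3_coN u i : co (- u) i = - co u i.
Proof. by rewrite -scaleN1r s3_coZ mulN1r. Qed.
Lemma s3_co_sum (I : finType) (F : I -> s3 K n) i :
  co (\sum_j F j) i = \sum_j co (F j) i.
Proof. by elim/big_rec2: _ => [|j a b _ <-]; rewrite ?s3_co0 ?s3_coD. Qed.
Lemma s3_co_e i k : co (s3_e i) k = ((k == i) && (k <= n)%N)%:R.
Proof.
case: (leqP k n) => h; last by rewrite s3_co_out ?andbF.
by rewrite -[k]/(val (Ordinal (h : (k < n.+1)%N))) s3_coE mxE andbT.
Qed.

Lemma s3_sum_pick (F : 'I_n.+1 -> K) (f : nat -> K) i :
  (forall j, F j = f j * (j == i :> nat)%:R) -> ((n < i)%N -> f i = 0) ->
  \sum_j F j = f i.
Proof.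
move=> hF h; case: (ltnP i n.+1) => hi; last first.
  rewrite h // big1 // => j _; rewrite hF (_ : (j == i :> nat) = false) ?mulr0 //.
  by apply/negbTE; rewrite neq_ltn (leq_trans (ltn_ord j)).
rewrite (bigD1 (Ordinal hi)) //= hF /= eqxx mulr1 big1 ?addr0 // => j hj.
by rewrite hF (_ : (j == i :> nat) = false) ?mulr0 //; apply: negbTE.
Qed.

Lemma s3_co_table (i j : 'I_n.+1) k : co (s3_table i j) k =
  (if (3 <= k <= n)%N then (i == k.-1 :> nat)%:R else 0) * (j == 1 :> nat)%:R
  + ((if (1 <= k <= n)%N then (k - 1)%:R * (i == k :> nat)%:R else 0)
     + (if ((k == 1) || (k == 2)) && (k <= n)%N then (i == 1 :> nat)%:R else 0))
    * (j == 0 :> nat)%:R.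
Proof.
have hi := ltn_ord i; rewrite /s3_table.
case: (eqVneq (j : nat) 1) => [->|_]; rewrite ?eqxx /=.
  rewrite mulr1 mulr0 addr0; case: ifP => h; rewrite ?s3_co_e ?s3_co0.
    case: ifP => hk; last by rewrite (_ : _ && _ = false) //; lia.
    by congr (_%:R); lia.
  by case: ifP => // hk; rewrite (_ : _ == _ = false) //; lia.
rewrite mulr0 add0r.
case: (eqVneq (j : nat) 0) => [_|_]; rewrite /= ?mulr1 ?mulr0 ?s3_co0 //.
case: (eqVneq (i : nat) 1) => [->|i1].
  rewrite s3_coD !s3_co_e; case: k => [|[|[|k]]]; rewrite /= ?andbF ?addr0 //.
  - by case: ifP => h; rewrite ?mul0r ?add0r ?addr0 ?h //=; move: h; case: (n).
  - by case: ifP => h; rewrite ?mulr0 ?add0r ?h.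
  - by case: ifP => _; rewrite ?mulr0 ?addr0.
rewrite if_same addr0.
case: (ltnP 1 i) => h2 /=; last first.
  rewrite s3_co0; case: ifP => // hk.
  by rewrite (_ : _ == _ = false) ?mulr0 //; lia.
rewrite (_ : (i <= n)%N = true) //= s3_coZ s3_co_e.
case: (eqVneq k i) => [->|ki] /=.
  have -> : (0 < i <= n)%N by lia.
  by rewrite ?eqxx -ltnS hi.
by rewrite !mulr0 if_same.
Qed.

Lemma s3_co_half (u v : s3 K n) k : (k <= n)%N ->
  \sum_(i < n.+1) \sum_(j < n.+1) (u 0 i * v 0 j) * co (s3_table i j) k
  = s3_hco u v k.
Proof.
move=> kn.
pose A (i : 'I_n.+1) : K := if (3 <= k <= n)%N then (i == k.-1 :> nat)%:R else 0.
pose B (i : 'I_n.+1) : K :=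
  ((if (1 <= k <= n)%N then (k - 1)%:R * (i == k :> nat)%:R else 0)
     + (if ((k == 1) || (k == 2)) && (k <= n)%N then (i == 1 :> nat)%:R else 0)).
transitivity (\sum_(i < n.+1) (u 0 i * A i * co v 1 + u 0 i * B i * co v 0)).
  apply: eq_bigr => i _.
  transitivity (\sum_(j < n.+1) (u 0 i * A i * v 0 j * (j == 1 :> nat)%:R)
     + \sum_(j < n.+1) (u 0 i * B i * v 0 j * (j == 0 :> nat)%:R)).
    rewrite -big_split; apply: eq_bigr => j _ /=.
    by rewrite s3_co_table -/(A i) -/(B i); ring.
  congr (_ + _).
    apply: (s3_sum_pick (f := fun j => u 0 i * A i * co v j)) => [j|h];
      by rewrite ?s3_coE // s3_co_out ?mulr0.
  apply: (s3_sum_pick (f := fun j => u 0 i * B i * co v j)) => [j|h];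
    by rewrite ?s3_coE // s3_co_out ?mulr0.
rewrite big_split -!mulr_suml /s3_hco; congr (_ + _); rewrite mulrC; congr (_ * _).
  rewrite /A kn andbT; case: ifP => h3; last by rewrite big1 // => i _; rewrite mulr0.
  by apply: s3_sum_pick => [j|hh]; rewrite ?s3_coE // s3_co_out.
rewrite /B kn !andbT; under eq_bigr do rewrite mulrDr; rewrite big_split /=.
congr (_ + _).
  case: ifP => h3; last by rewrite big1 // => i _; rewrite mulr0.
  apply: (s3_sum_pick (f := fun i => (k - 1)%:R * co u i)) => [j|hh].
    by rewrite s3_coE; ring.
  by rewrite s3_co_out ?mulr0.
transitivity (if (k == 1) || (k == 2) then co u 1 else 0); last by do 2!case: eqP.
case: ifP => h3; last by rewrite big1 // => i _; rewrite mulr0.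
by apply: s3_sum_pick => [j|hh]; rewrite ?s3_coE // s3_co_out.
Qed.

Lemma s3_co_lieb u v k : (k <= n)%N -> co (s3_lieb u v) k = s3_hco u v k - s3_hco v u k.
Proof.
move=> kn; rewrite -!s3_co_half // [X in _ - X]exchange_big /= -sumrB s3_co_sum.
apply: eq_bigr => i _; rewrite s3_co_sum -sumrB; apply: eq_bigr => j _.
by rewrite s3_coZ s3_coD s3_coN; ring.
Qed.

Lemma s3_lieb_linearr u : linear (s3_lieb u).
Proof.
move=> a v w; apply: s3_coP => k kn; rewrite s3_coD s3_coZ !s3_co_lieb // /s3_hco !(s3_coD, s3_coZ).
by case: ifP => _; case: ifP => _; do 2?[case: ifP => _]; ring.
Qed.

Lemma s3_lieb_anti u v : s3_lieb u v = - s3_lieb v u.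
Proof. by apply: s3_coP => k kn; rewrite s3_coN !s3_co_lieb // opprB. Qed.

Lemma s3_lieb_jacobi u v w :
  s3_lieb u (s3_lieb v w) + s3_lieb v (s3_lieb w u)
  + s3_lieb w (s3_lieb u v) = 0.
Proof.
have l0 a b : co (s3_lieb a b) 0 = 0 by rewrite s3_co_lieb // /s3_hco /=; ring.
apply: s3_coP => k kn; rewrite !s3_coD s3_co0 !s3_co_lieb // /s3_hco !l0.
case: k kn => [|[|[|[|k]]]] kn /=; rewrite ?l0; first by ring.
all: rewrite !s3_co_lieb // /s3_hco ?l0 //=; try lia.
all: rewrite ?subnn ?subSS ?subn0.
all: try by ring.
Qed.

HB.instance Definition _ := isLieAlgebra.Build K (s3 K n)
  s3_lieb_linearr s3_lieb_anti s3_lieb_jacobi.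

Definition s3_nil : {vspace s3 K n} := <<[seq s3_e i | i <- iota 1 n]>>%VS.

Lemma s3_lieb0 u v : s3_lieb u v 0 0 = 0.
Proof. by rewrite -(s3_coE _ 0) s3_co_lieb // /s3_hco /=; ring. Qed.

Definition s3_tail k : {vspace s3 K n} := <<[seq s3_e i | i <- iota k.+1 (n - k)]>>%VS.

Local Notation tail := s3_tail.

Lemma s3_memv_tail k (u : s3 K n) :
  reflect (forall i : 'I_n.+1, (i <= k)%N -> u 0 i = 0) (u \in tail k).
Proof.
apply: (iffP idP) => [|u0].
  move/coord_span => -> i ik; rewrite summxE big1 // => j _.
  have hj : (j < n - k)%N.
    by move: (ltn_ord j); rewrite ?size_map ?size_iota.
  rewrite mxE /= (nth_map 0%N) ?size_iota // nth_iota // mxE.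
  by rewrite (_ : _ == _ = false) ?mulr0 //; lia.
have -> : u = \sum_(j < n.+1) u 0 j *: s3_e j.
  apply/rowP => i; rewrite summxE (bigD1 i) //= !mxE eqxx mulr1 big1 ?addr0 //.
  by move=> j ij; rewrite !mxE (_ : _ == _ = false) ?mulr0 // eq_sym; apply: negbTE.
rewrite rpred_sum // => j _; case: (leqP j k) => jk.
  by rewrite u0 // scale0r mem0v.
rewrite rpredZ //; apply: memv_span; apply: map_f; rewrite mem_iota.
by have := ltn_ord j; lia.
Qed.

Lemma memv_s3_nil (u : s3 K n) : (u \in s3_nil) = (u 0 0 == 0).
Proof.
rewrite (_ : s3_nil = tail 0); last by rewrite /s3_tail subn0.
apply/s3_memv_tail/eqP => [->//|u0 i].
by rewrite leqn0 => /eqP i0; rewrite (_ : i = 0) //; apply: val_inj.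
Qed.

Lemma s3_nilradical : (3 <= n)%N -> is_nilradical s3_nil.
Proof.
move=> n3; split=> [x y _||I idI [k nilI]].
- by rewrite memv_s3_nil; apply/eqP; apply: s3_lieb0.
- have sub k : (iter k (lie_prod s3_nil) s3_nil <= tail k)%VS.
    elim: k => [|k IH]; first by rewrite /s3_tail subn0.
    apply: lie_prod_sub => u w; rewrite memv_s3_nil => /eqP u0 /(subvP IH).
    move/s3_memv_tail => w0; apply/s3_memv_tail => i ik; rewrite -s3_coE.
    have cw j : (j <= k)%N -> co w j = 0.
      case: (ltnP j n.+1) => hj jk; last by rewrite s3_co_out.
      by rewrite -[j]/(val (Ordinal hj)) s3_coE w0.
    have cu : co u 0 = 0 by rewrite -u0 -(s3_coE u 0).
    rewrite [lieb u w]/(s3_lieb u w) s3_co_lieb ?leq_ord // /s3_hco cu (cw 0%N) //.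
    case: (leqP 3 i) => h; last by rewrite !(mul0r, mulr0, addr0, subrr).
    rewrite (cw 1%N) ?(cw i.-1); try lia.
    by rewrite !(mul0r, mulr0, addr0, subrr).
  exists n; apply/eqP; rewrite -subv0; apply: subv_trans (sub n) _.
  by rewrite /s3_tail subnn span_nil.
- apply/subvP => u uI; rewrite memv_s3_nil; apply/negPn/negP => u0.
  have brE : lieb u (s3_e n : s3 K n) = - (u 0 0 * (n - 1)%:R) *: (s3_e n : s3 K n).
    apply: s3_coP => i iN; rewrite s3_coZ [lieb _ _]/(s3_lieb _ _) s3_co_lieb // /s3_hco !s3_co_e.
    have [n0 n1] : (0 == n) = false /\ (1 == n) = false by lia.
    rewrite -(s3_coE u 0) /= n0 n1 /=.
    case: (eqVneq i n) => [ein|ine] /=.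
      have [i1 i2] : (i == 1) = false /\ (i == 2) = false by lia.
      have [in1 i0] : (i.-1 == n) = false /\ (0 < i)%N by lia.
      by rewrite i1 i2 in1 i0 iN ein; case: ifP => _ /=; ring.
    have -> : (i.-1 == n) = false by lia.
    by rewrite /= !(mul0r, mulr0, addr0, if_same, oppr0).
  have eX (X : {vspace s3 K n}) :
      lieb u (s3_e n : s3 K n) \in X -> (s3_e n : s3 K n) \in X.
    rewrite brE rpredZeq oppr_eq0 mulf_eq0 (negbTE u0) pnatr_eq0 /=.
    by rewrite (_ : (n - 1 == 0)%N = false) //; lia.
  have eI : (s3_e n : s3 K n) \in I.
    by apply: eX; rewrite lieb_anti rpredN; apply: idI.
  have el j : (s3_e n : s3 K n) \in iter j (lie_prod I) I.
    by elim: j => [//|j IH]; apply: eX; apply: memv_lie_prod.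
  have := el k; rewrite nilI memv0 => /eqP /(congr1 (co^~ n)).
  by rewrite s3_co_e s3_co0 eqxx leqnn => /eqP; rewrite oner_eq0.
Qed.

End S3.

(* Main.v *)
From HB Require Import structures.
Require Import Defs.
From mathcomp Require Import all_boot all_order all_algebra.
From mathcomp Require Import reals complex.
From mathcomp Require Import ring zify.

(** A one-dimensional extension of s3 n is given by a line V, a character by
    which L acts on V, and a V-valued 2-cocycle. Reading V in a coordinate l
    gives a scalar cocycle b, and the character is u |-> t * u_0 because the
    nilradical acts trivially. Everything is then a weight computation for the
    derivation D = [_, x] of the nilradical.

    Write e_i, e_j for basis vectors with i, j >= 2. The cocycle identity
    on (e_i, e_j, x) says that b(e_i, e_j) has weight i + j - 2 against a
    cocycle of weight -t, so it vanishes unless i + j - 2 = -t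
    ([cocycle_ei_ej]). The identity on (e_i, e_j, e_1) says that
    b(e_i+1, e_j) = - b(e_i, e_j+1) ([cocycle_shift]), and the one on
    (e_i, e_1, x) relates b(e_i, e_1) to b(e_i, e_2) and b(e_i+1, x)
    ([cocycle_ei_e1]).

    Since e_{n+1} = 0, these relations at i = n force b(e_n, e_j) = 0 for
    j >= 2. As e_n is central in the nilradical, non-splitness leaves only
    b(e_n, e_1) != 0 ([non_split_en_e1]), and then t = -n ([cocycle_weight]).
    The weights now kill every b(e_i, e_j) with i + j != n + 2, and the shift
    relation carries b(e_n, e_2) = 0 along the antidiagonal i + j = n + 2, so
    b vanishes on all pairs e_i, e_j ([cocycle_ei_ej0]).

    The values b(e_i, x) can be absorbed by a linear functional c, because
    n + 1 - i is invertible for i <= n; the values b(e_i, e_1) with i < n are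
    then absorbed too. So, up to the coboundary of c, the cocycle is a nonzero
    multiple of the one taking the value 1 on (e_n, e_1)
    ([cocycle_normal_form]). That cocycle defines s3 (n+1), with the generator
    of V as e_{n+1}: [ext_to_s3] is the resulting isomorphism. *)

Set Implicit Arguments.
Unset Strict Implicit.
Unset Printing Implicit Defensive.

Import Order.TTheory GRing.Theory Num.Theory.
Local Open Scope ring_scope.

(** * Brackets of basis vectors *)

Section Brackets.
Context (K : numFieldType) (n : nat).
Local Notation L := (s3 K n).
Local Notation co := (@s3_co K n).
Local Notation e := (s3_e K n).

Lemma s3_e_out i : (n < i)%N -> e i = 0.
Proof.
move=> ni; apply: s3_coP => k kn; rewrite s3_co_e s3_co0.
by rewrite (_ : _ && _ = false) //; lia.
Qed.

Lemma s3_sum_e (u : L) : u = \sum_(i < n.+1) co u i *: e i.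
Proof.
apply: s3_coP => k kn; rewrite s3_co_sum; symmetry.
apply: (s3_sum_pick (f := co u)) => [j|]; last by lia.
by rewrite s3_coZ s3_co_e kn andbT eq_sym.
Qed.

Lemma s3_co_bracket (u v : L) k :
  (k <= n)%N -> co (lieb u v) k = s3_hco u v k - s3_hco v u k.
Proof. exact: s3_co_lieb. Qed.

Lemma s3_bracket_ei_e1 i :
  (2 <= i)%N -> lieb (e i : L) (e 1) = e i.+1.
Proof.
move=> i2; apply: s3_coP => k kn; rewrite s3_co_bracket // /s3_hco !s3_co_e.
have [-> [-> ->]] : (0 == i) = false /\ (1 == i) = false /\ (0 == 1 :> nat) = false by lia.
rewrite kn andbT.
case: (leqP 1 n) => n1; last first.
  by rewrite andbF (_ : (k == i.+1) = false) /=; [ring|lia].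
case: (leqP 3 k) => k3; last by rewrite (_ : (k == i.+1) = false) /=; [ring|lia].
rewrite (_ : (k.-1 == i) && (k.-1 <= n)%N = (k == i.+1)); last by lia.
by rewrite /= !andbT; ring.
Qed.

Lemma s3_bracket_ei_x i :
  (2 <= i)%N -> lieb (e i : L) (e 0) = (i - 1)%:R *: e i.
Proof.
move=> i2; apply: s3_coP => k kn; rewrite s3_co_bracket // /s3_hco s3_coZ !s3_co_e.
have [-> [-> ->]] : (0 == i) = false /\ (1 == i) = false /\ (1 == 0 :> nat) = false by lia.
rewrite kn !andbT /=; case: (eqVneq k i) => [->|_] /=.
  by rewrite (_ : (0 < i)%N) ?if_same; [ring|lia].
by rewrite ?mulr0n mulr0 !if_same; ring.
Qed.

Lemma s3_bracket_e1_x : lieb (e 1 : L) (e 0) = e 1 + e 2.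
Proof.
apply: s3_coP => k kn; rewrite s3_co_bracket // /s3_hco s3_coD !s3_co_e.
case: k kn => [|k] kn /=; first by ring.
have -> : (1 <= n)%N by apply: leq_trans kn.
by case: k kn => [|[|k]] kn; rewrite ?kn /= ?mulr0n; ring.
Qed.

Lemma s3_bracket_ei_ej i j :
  (2 <= i)%N -> (2 <= j)%N -> lieb (e i : L) (e j) = 0.
Proof.
move=> i2 j2; apply: s3_coP => k kn; rewrite s3_co_bracket // /s3_hco s3_co0 !s3_co_e.
have [-> ->] : (0 == i) = false /\ (1 == i) = false by lia.
have [-> ->] : (0 == j) = false /\ (1 == j) = false by lia.
by rewrite /=; ring.
Qed.

(** * Reduction of forms to the basis *)

Lemma s3_functional_sum (f : L -> K) u :
  (forall a v w, f (a *: v + w) = a * f v + f w) ->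
  f u = \sum_(i < n.+1) co u i * f (e i).
Proof.
move=> fP; have f0 : f 0 = 0.
  by have := fP (-1) 0 0; rewrite scaler0 addr0 mulN1r addNr.
rewrite {1}(s3_sum_e u).
by elim/big_rec2: _ => [//|i x y _ <-]; rewrite fP.
Qed.

Lemma s3_alternating_eq0 (d : L -> L -> K) :
  (forall u a v w, d u (a *: v + w) = a * d u v + d u w) ->
  (forall u v, d u v = - d v u) ->
  (forall i j, (j < i)%N -> d (e i) (e j) = 0) ->
  forall u v, d u v = 0.
Proof.
move=> dl da d0 u v; rewrite (s3_functional_sum v (dl u)) big1 // => j _.
rewrite da (s3_functional_sum u (dl _)) big1 ?oppr0 ?mulr0 // => i _.
case: (ltngtP i j) => [/d0->|/d0 h|->]; rewrite ?mulr0 //.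
  by rewrite da h oppr0 mulr0.
have /eqP := da (e j) (e j); rewrite -subr_eq0 opprK -mulr2n mulrn_eq0 /=.
by move/eqP->; rewrite mulr0.
Qed.

(** * Scalar cocycles *)

(** A 2-cocycle with values in a line on which L acts by the character
    u |-> t * u_0, read in a coordinate of the line. *)
Record line_cocycle (t : K) (b : L -> L -> K) : Prop := LineCocycle {
  line_cocycle_linear : forall u a v w, b u (a *: v + w) = a * b u v + b u w;
  line_cocycle_anti : forall u v, b u v = - b v u;
  line_cocycle_closed : forall u v w,
    b u (lieb v w) + b w (lieb u v) + b v (lieb w u)
    + t * (co u 0 * b v w + co w 0 * b u v + co v 0 * b w u) = 0
}.

Section Cocycle.
Context (t : K) (b : L -> L -> K) (bP : line_cocycle t b).

Lemma cocycleDr u v w : b u (v + w) = b u v + b u w.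
Proof. by rewrite -[v]scale1r (line_cocycle_linear bP) mul1r scale1r. Qed.

Lemma cocycle0r u : b u 0 = 0.
Proof. by apply: (addrI (b u 0)); rewrite -cocycleDr !addr0. Qed.

Lemma cocycleZr u a v : b u (a *: v) = a * b u v.
Proof. by rewrite -[a *: v]addr0 (line_cocycle_linear bP) cocycle0r addr0. Qed.

Lemma cocycleNr u v : b u (- v) = - b u v.
Proof. by rewrite -scaleN1r cocycleZr mulN1r. Qed.

(** The cocycle identity on (e_i, e_j, x): e_i and e_j have weights i - 1 and
    j - 1 under [_, x] and commute. *)
Lemma cocycle_ei_ej i j : (2 <= i)%N -> (2 <= j)%N ->
  ((i + j - 2)%:R + t) * b (e i) (e j) = 0.
Proof.
move=> i2 j2; have := line_cocycle_closed bP (e i) (e j) (e 0).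
rewrite s3_bracket_ei_x // s3_bracket_ei_ej // cocycle0r.
rewrite (lieb_anti (e 0)) s3_bracket_ei_x // cocycleNr !cocycleZr !s3_co_e.
have [-> ->] : (0 == i) = false /\ (0 == j) = false by lia.
rewrite (line_cocycle_anti bP (e j) (e i)) => /= <-.
by rewrite (_ : (i + j - 2 = (i - 1) + (j - 1))%N) ?natrD; [ring|lia].
Qed.

(** The cocycle identity on (e_i, e_j, e_1). *)
Lemma cocycle_shift i j : (2 <= i)%N -> (2 <= j)%N ->
  b (e i.+1) (e j) = - b (e i) (e j.+1).
Proof.
move=> i2 j2; have := line_cocycle_closed bP (e i) (e j) (e 1).
rewrite s3_bracket_ei_e1 // s3_bracket_ei_ej // cocycle0r.
rewrite (lieb_anti (e 1)) s3_bracket_ei_e1 // cocycleNr !s3_co_e.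
have [-> ->] : (0 == i) = false /\ (0 == j) = false by lia.
rewrite (line_cocycle_anti bP (e j) (e i.+1)) /= => h.
by apply: (addrI (b (e i) (e j.+1))); rewrite subrr -[RHS]h; ring.
Qed.

(** The cocycle identity on (e_i, e_1, x). The extra term b(e_i, e_2) comes
    from the non-diagonal part of [e_1, x] = e_1 + e_2. *)
Lemma cocycle_ei_e1 i : (2 <= i)%N ->
  (i%:R + t) * b (e i) (e 1) + b (e i) (e 2) = b (e i.+1) (e 0).
Proof.
move=> i2; have := line_cocycle_closed bP (e i) (e 1) (e 0).
rewrite s3_bracket_e1_x s3_bracket_ei_e1 // (lieb_anti (e 0)) s3_bracket_ei_x //.
rewrite cocycleNr cocycleDr cocycleZr !s3_co_e.
have -> : (0 == i) = false by lia.
rewrite (line_cocycle_anti bP (e 1) (e i)) (line_cocycle_anti bP (e 0) (e i.+1)) /=.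
move=> h; apply: (addIr (- b (e i.+1) (e 0))); rewrite subrr -[RHS]h.
by rewrite -{1}(subnK (ltnW i2)) natrD; ring.
Qed.

Hypothesis n3 : (3 <= n)%N.

(** For j = 2, [cocycle_ei_ej] and [cocycle_ei_e1] at i = n give
    (n + t) b(e_n, e_2) = 0 and (n + t) b(e_n, e_1) + b(e_n, e_2) = 0, which
    kill b(e_n, e_2) whether or not n + t vanishes. For j > 2, shift e_n to
    e_{n+1} = 0. *)
Lemma cocycle_en_ej j : (2 <= j)%N -> b (e n) (e j) = 0.
Proof.
have n2 := ltnW n3.
case: j => [|[|[|j]]] // _.
  have := cocycle_ei_e1 n2; rewrite (s3_e_out (ltnSn n)) (line_cocycle_anti bP 0) cocycle0r oppr0.
  have /eqP := cocycle_ei_ej n2 (leqnn 2); rewrite addnK mulf_eq0.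
  by case/orP=> /eqP ->; rewrite ?mul0r ?add0r.
apply: oppr_inj; rewrite -cocycle_shift // (s3_e_out (ltnSn n)).
by rewrite (line_cocycle_anti bP) cocycle0r.
Qed.

(** The only obstruction to e_n lying in the annihilator of b restricted to the
    nilradical is the value b(e_n, e_1). *)
Lemma cocycle_en u : co u 0 = 0 -> b (e n) u = co u 1 * b (e n) (e 1).
Proof.
move=> u0; rewrite (s3_functional_sum u (line_cocycle_linear bP _)).
apply: (s3_sum_pick (f := fun i => co u i * b (e n) (e 1))) => [j|]; last by lia.
case: (ltnP 1 j) => [j2|].
  by rewrite cocycle_en_ej // (_ : (j == 1 :> nat) = false) ?mulr0 //; lia.
by case: (nat_of_ord j) => [|[|k]] //; rewrite ?u0 /= ?mulr1 ?mul0r.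
Qed.

Hypothesis bn1 : b (e n) (e 1) != 0.

Lemma cocycle_weight : t = - n%:R.
Proof.
have := cocycle_ei_e1 (ltnW n3); rewrite (cocycle_en_ej (leqnn 2)) addr0 (s3_e_out (ltnSn n)).
rewrite (line_cocycle_anti bP 0) cocycle0r oppr0 => /eqP.
rewrite mulf_eq0 (negbTE bn1) orbF addrC addr_eq0.
by move/eqP.
Qed.

(** With t = -n, only the pairs with i + j = n + 2 have the right weight; on
    those, the shift relation leads back to b(e_n, e_2) = 0. *)
Lemma cocycle_ei_ej0 i j : (2 <= i)%N -> (2 <= j)%N -> b (e i) (e j) = 0.
Proof.
move=> i2 j2; case: (eqVneq (i + j)%N n.+2) => [ij|ij]; last first.
  have /eqP := cocycle_ei_ej i2 j2; rewrite cocycle_weight mulf_eq0.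
  by rewrite subr_eq0 eqr_nat (_ : (_ == _)%N = false); [move/eqP|lia].
(* Induction on the distance j - 2 from the end (n, 2) of the antidiagonal. *)
have -> : i = (n - (j - 2))%N by lia.
have -> : j = (j - 2).+2 by lia.
have : ((j - 2).+2 <= n)%N by lia.
rewrite !subSS !subn0; elim: (j - 2)%N => [|k IH] kn.
  by rewrite subn0 cocycle_en_ej.
apply: oppr_inj; rewrite -cocycle_shift ?oppr0; try lia.
by rewrite subnSK ?IH //; lia.
Qed.

(** The functional whose coboundary, for the action with t = -n, agrees with b
    on the pairs (e_i, x). The values for i >= 2 solve (n + 1 - i) c_i = - b(e_i, x); since
    [e_1, x] = e_1 + e_2, the value at 1 solves (n - 1) c_1 = c_2 - b(e_1, x).
    For i > n both e_i and n.+1 - i are 0, so the coefficient is 0. *)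
Definition cobounding_coef i : K :=
  let c j := - b (e j) (e 0) / (n.+1 - j)%:R in
  if i is i'.+1 then
    if i' is 0 then (c 2 - b (e 1) (e 0)) / (n - 1)%:R else c i
  else 0.

Definition cobounding u : K := \sum_(i < n.+1) co u i * cobounding_coef i.

Lemma cobounding_linear a u v :
  cobounding (a *: u + v) = a * cobounding u + cobounding v.
Proof.
rewrite mulr_sumr -big_split; apply: eq_bigr => i _ /=.
by rewrite s3_coD s3_coZ; ring.
Qed.

Lemma coboundingD u v : cobounding (u + v) = cobounding u + cobounding v.
Proof. by rewrite -[u in LHS]scale1r cobounding_linear mul1r. Qed.

Lemma cobounding0 : cobounding 0 = 0.
Proof. by apply: (addrI (cobounding 0)); rewrite -coboundingD !addr0. Qed.

Lemma coboundingZ a u : cobounding (a *: u) = a * cobounding u.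
Proof. by rewrite -[a *: u]addr0 cobounding_linear cobounding0 addr0. Qed.

Lemma coboundingN u : cobounding (- u) = - cobounding u.
Proof. by rewrite -scaleN1r coboundingZ mulN1r. Qed.

Lemma cobounding_e i : cobounding (e i) = cobounding_coef i.
Proof.
apply: s3_sum_pick => [j|ni].
  by rewrite s3_co_e -ltnS ltn_ord andbT mulrC.
case: i ni => [|[|i]] //= ni; first by lia.
by rewrite (s3_e_out ni) (line_cocycle_anti bP) cocycle0r !oppr0 mul0r.
Qed.

(** Both sides are alternating, so it suffices to compare them on basis pairs.
    On (e_i, x) they agree by the choice of the functional; on (e_i, e_1) with
    i < n because [cocycle_ei_e1] reads (i - n) b(e_i, e_1) = b(e_i+1, x),
    that is, b(e_i, e_1) = c_i+1; on (e_n, e_1) the functional contributes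
    c(e_{n+1}) = 0 and the middle term remains. *)
Lemma cocycle_normal_form u v :
  b u v = cobounding (lieb u v)
    + b (e n) (e 1) * (co u n * co v 1 - co u 1 * co v n)
    + n%:R * (co u 0 * cobounding v - co v 0 * cobounding u).
Proof.
apply/eqP; rewrite -subr_eq0; apply/eqP; move: u v; have n2 := ltnW n3; apply: s3_alternating_eq0.
- move=> u a v w.
  rewrite (line_cocycle_linear bP) lieb_linearr !cobounding_linear !s3_coD !s3_coZ.
  by ring.
- move=> u v.
  by rewrite (line_cocycle_anti bP) lieb_anti coboundingN; ring.
have nz k : (0 < k)%N -> k%:R != 0 :> K by rewrite pnatr_eq0 lt0n.
case=> [|[|i]] [|[|j]] // ji.
- rewrite s3_bracket_e1_x coboundingD !cobounding_e /cobounding_coef.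
  set c2 := - _ / _; rewrite !s3_co_e.
  have [-> ->] : (n == 0)%N = false /\ (n == 1)%N = false by lia.
  have := nz (n - 1)%N; rewrite subn_gt0 natrB ?(ltnW n2) //= => /(_ n2) h.
  by field.
- rewrite s3_bracket_ei_x // coboundingZ !cobounding_e /= !s3_co_e leq0n /=.
  case: (leqP i.+2 n) => [im|nm]; last first.
    by rewrite (s3_e_out nm) (line_cocycle_anti bP) cocycle0r; ring.
  have := nz (n.+1 - i.+2)%N; rewrite subn_gt0 ltnS im => /(_ isT).
  rewrite subSS subn1 (natrB _ (ltnW im)) => h /=.
  by rewrite !mulr0; field; rewrite nat1r.
- have := cocycle_ei_e1 (isT : 2 <= i.+2)%N.
  rewrite (cocycle_ei_ej0 (isT : 2 <= i.+2)%N (leqnn 2)) addr0 cocycle_weight.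
  rewrite s3_bracket_ei_e1 // cobounding_e /= !s3_co_e leqnn (ltnW n2) /= => <-.
  have -> : (n == 1)%N = false by lia.
  case: (ltngtP i.+2 n) => [im|nm|->] /=.
  - have := nz (n - i.+2)%N; rewrite subn_gt0 => /(_ im).
    rewrite subSS (natrB _ (ltnW im)) => h.
    by field; rewrite -natrD.
  - by rewrite (s3_e_out nm) (line_cocycle_anti bP) cocycle0r; ring.
  by ring.
by rewrite s3_bracket_ei_ej // cocycle_ei_ej0 // cobounding0 !s3_co_e /=; ring.
Qed.

End Cocycle.
End Brackets.

(** * Linear preliminaries *)

Lemma line_coord (K : fieldType) (V : vectType K) :
  \dim {:V} = 1%N ->
  exists l : V -> K, exists v0 : V,
    [/\ forall a u w, l (a *: u + w) = a * l u + l w,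
        forall a, l (a *: v0) = a & forall w, w = l w *: v0].
Proof.
move=> dimV; pose v0 := vpick {:V}.
have v0n0 : v0 != 0 by rewrite vpick0 -dimv_eq0 dimV.
have basV : basis_of {:V} [tuple v0].
  by rewrite basisEfree seq1_free v0n0 subvf dimV.
exists (coord [tuple v0] ord0), v0.
have lP w : w = coord [tuple v0] ord0 w *: v0.
  by rewrite {1}(coord_basis basV (memvf w)) big_ord1.
split=> // [a u w|a]; first by rewrite linearP.
have /eqP := lP (a *: v0); rewrite -subr_eq0 -scalerBl scaler_eq0.
by rewrite (negbTE v0n0) orbF subr_eq0 eq_sym => /eqP.
Qed.

Lemma linear_hom (K : fieldType) (V W : vectType K) (f : V -> W) :
  linear f -> exists g : 'Hom(V, W), g =1 f.
Proof.
move=> fP.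
pose F : {linear V -> W} := HB.pack f (GRing.isLinear.Build _ _ _ _ f fP).
by exists (linfun F) => u; rewrite lfunE.
Qed.

Lemma is_nilradical_uniq (K : numFieldType) (L : lieAlgType K)
    (M N : {vspace L}) :
  is_nilradical M -> is_nilradical N -> M = N.
Proof.
move=> [idM nilM maxM] [idN nilN maxN].
by apply/eqP; rewrite eqEsubv maxN // maxM.
Qed.

(** * The isomorphism *)

Section Extension.
Context (K : numFieldType) (n : nat) (V : vectType K).
Context (E : extension (s3 K n) V) (l : V -> K) (v0 : V).
Local Notation L := (s3 K n).
Local Notation co := (@s3_co _ _).
Local Notation e := (s3_e K n).
Hypothesis l_linear : forall a u w, l (a *: u + w) = a * l u + l w.
Hypothesis l_v0 : forall a, l (a *: v0) = a.
Hypothesis lK : forall w, w = l w *: v0.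
Hypothesis E_nil : (s3_nil K n <= lker (ext_rep E))%VS.

Lemma line_coordD u w : l (u + w) = l u + l w.
Proof. by rewrite -[u]scale1r l_linear mul1r scale1r. Qed.

Lemma line_coord0 : l 0 = 0.
Proof. by rewrite -(scale0r v0) l_v0. Qed.

Lemma line_coordZ a w : l (a *: w) = a * l w.
Proof. by rewrite {1}(lK w) scalerA l_v0. Qed.

Lemma line_coordN w : l (- w) = - l w.
Proof. by rewrite -scaleN1r line_coordZ mulN1r. Qed.

Let t : K := l (ext_rep E (e 0 : L) v0).
Let b (u v : L) : K := l (ext_cocycle E u v).

(** u differs from u_0 x by an element of the nilradical, which acts
    trivially. *)
Lemma line_ext_rep u w : l (ext_rep E u w) = co u 0 * t * l w.
Proof.
have ker_u : u - co u 0 *: (e 0 : L) \in lker (ext_rep E).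
  apply: (subvP E_nil); rewrite memv_s3_nil -s3_coE /=.
  by rewrite s3_coD s3_coN s3_coZ s3_co_e /= mulr1 subrr.
rewrite -[u in LHS](subrK (co u 0 *: (e 0 : L))) linearD lfunE /=.
move: ker_u; rewrite memv_ker => /eqP ->.
rewrite lfunE add0r linearZ lfunE /= line_coordZ.
by rewrite {1}(lK w) linearZ line_coordZ /t; ring.
Qed.

Lemma ext_line_cocycle : line_cocycle t b.
Proof.
split=> [u a v w|u v|u v w]; rewrite /b.
- by rewrite linearP l_linear.
- by rewrite ext_cocycle_anti line_coordN.
have /(congr1 l) := ext_cocycleP E u v w.
rewrite !line_coordD !line_ext_rep line_coord0 => h.
by rewrite -[RHS]h; ring.
Qed.

Hypothesis n3 : (3 <= n)%N.

(** If b(e_n, e_1) = 0 then e_n annihilates the nilradical under the cocycle;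
    it is also central there, contradicting non-splitness. *)
Lemma non_split_en_e1 : non_split E (s3_nil K n) -> b (e n) (e 1) != 0.
Proof.
move=> ns; apply/eqP => b0.
have enN : (e n : L) \in s3_nil K n.
  by rewrite memv_s3_nil -s3_coE s3_co_e /= (_ : (0 == n)%N = false) //; lia.
have : (e n : L) = 0.
  apply: ns; split=> // u; rewrite memv_s3_nil -s3_coE => /eqP u0.
    rewrite (lK (ext_cocycle E _ _)) -/(b _ _) (cocycle_en ext_line_cocycle) //.
    by rewrite b0 mulr0 scale0r.
  rewrite (s3_sum_e u) lieb_sumr big1 // => -[[|[|i]] iP] _ /=.
  - by rewrite u0 scale0r.
  - by rewrite s3_bracket_ei_e1 ?(ltnW n3) // s3_e_out ?scaler0.
  by rewrite s3_bracket_ei_ej ?(ltnW n3) // scaler0.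
move/(congr1 (fun u => co u n)); rewrite s3_co_e s3_co0 eqxx leqnn /=.
by apply/eqP; rewrite oner_eq0.
Qed.

Hypothesis bn1 : b (e n) (e 1) != 0.

Let c := cobounding b.
Let kappa := b (e n) (e 1).

(** Subtracting c straightens the complement s3 n of V inside the extension,
    and kappa normalizes the generator of V to [e_n, e_1]. *)
Definition ext_to_s3 (p : ext_type E) : s3 K n.+1 :=
  \row_(k < n.+2) if (k <= n)%N then co p.1 k else kappa^-1 * (l p.2 - c p.1).

Lemma ext_to_s3_lo p k : (k <= n)%N -> co (ext_to_s3 p) k = co p.1 k.
Proof.
move=> kn; rewrite -[k]/(val (Ordinal (leqW kn : (k < n.+2)%N))) s3_coE mxE /=.
by rewrite kn.
Qed.

Lemma ext_to_s3_hi p : co (ext_to_s3 p) n.+1 = kappa^-1 * (l p.2 - c p.1).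
Proof. by rewrite -[n.+1]/(val (@ord_max n.+1)) s3_coE mxE /= ltnn. Qed.

Lemma ext_to_s3_linear : linear ext_to_s3.
Proof.
move=> a p q; apply: s3_coP => k; rewrite s3_coD s3_coZ leq_eqVlt.
case/orP=> [/eqP->|kn].
  by rewrite !ext_to_s3_hi /= l_linear /c cobounding_linear; ring.
by rewrite !ext_to_s3_lo //= s3_coD s3_coZ.
Qed.

Lemma ext_to_s3_bij : bijective ext_to_s3.
Proof.
pose tr (w : s3 K n.+1) : L := \row_(k < n.+1) co w k.
have trE w k : (k <= n)%N -> co (tr w) k = co w k.
  by move=> kn; rewrite -[k]/(val (Ordinal (kn : (k < n.+1)%N))) s3_coE mxE.
exists (fun w => (tr w, (kappa * co w n.+1 + c (tr w)) *: v0) : ext_type E).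
  move=> p; have trp : tr (ext_to_s3 p) = p.1.
    by apply: s3_coP => k kn; rewrite trE // ext_to_s3_lo.
  rewrite trp ext_to_s3_hi mulVKf // subrK -lK.
  by case: p {trp}.
move=> w; apply: s3_coP => k; rewrite leq_eqVlt => /orP[/eqP->|kn].
  by rewrite ext_to_s3_hi /= l_v0 addrK mulKf.
by rewrite ext_to_s3_lo //= trE.
Qed.

(** Coordinates up to n come from s3 n, whose structure constants do not depend
    on n there; coordinate n + 1 is the normal form of the cocycle. *)
Lemma ext_to_s3_bracket p q :
  ext_to_s3 (lieb p q) = lieb (ext_to_s3 p) (ext_to_s3 q).
Proof.
apply: s3_coP => k; rewrite leq_eqVlt => /orP[/eqP->|kn]; last first.
  rewrite ext_to_s3_lo //= !s3_co_bracket ?(ltnW kn) // /s3_hco.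
  by rewrite !ext_to_s3_lo //; lia.
rewrite ext_to_s3_hi s3_co_bracket // /s3_hco /=.
rewrite !ext_to_s3_hi !ext_to_s3_lo //; try lia.
rewrite !line_coordD line_coordN !line_ext_rep -/(b _ _).
rewrite (cocycle_normal_form ext_line_cocycle) // (cocycle_weight ext_line_cocycle) //.
have -> : (3 <= n.+1)%N by lia.
have -> : (n.+1 == 1)%N = false by lia.
have -> : (n.+1 == 2)%N = false by lia.
rewrite subn1 /= -/c -/kappa.
have kappa0 : kappa != 0 := bn1.
by field.
Qed.

End Extension.

Theorem theorem5p8 (R : realType) (n : nat) (hn : (3 <= n)%N)
  (N : {vspace s3 R[i] n}) (hN : is_nilradical N)
  (V : vectType R[i]) (dimV : \dim {:V} = 1%N)
  (E : extension (s3 R[i] n) V) (hE : (N <= lker (ext_rep E))%VS)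
  (hns : non_split E N) :
  lie_isomorphic (ext_type E) (s3 R[i] n.+1).
Proof.
have NE := is_nilradical_uniq hN (s3_nilradical _ hn); subst N.
have [l [v0 [l_lin l_v0 lK]]] := line_coord dimV.
have bn1 := non_split_en_e1 l_lin l_v0 lK hE hn hns.
have [f fE] := linear_hom (@ext_to_s3_linear _ _ _ E _ l_lin).
exists f; split.
  exact: eq_bij (ext_to_s3_bij l_v0 lK bn1) _ (fsym fE).
by move=> p q; rewrite !fE; apply: ext_to_s3_bracket.
Qed.
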